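(* Let $c \ge 0$, $\alpha \in (0,1)$, $\eta > 1$, $m > 0$, $l_0 \ge 1$, and let $h:\mathbb{R}_{\ge 0}\to\mathbb{R}_{\ge 0}$ be increasing with $\sum_{k=0}^\infty 1/h(k) \le 1$. For $v \ge m$ define $$\mathcal{S}_\alpha(v) = \sqrt{k_1^2\, v\,\ell(v) + k_2^2 c^2 \ell^2(v)} + k_2\, c\,\ell(v),$$ where $$\ell(v) = \log h\!\left(\log_\eta (v/m)\right) + \log(l_0/\alpha),\qquad k_1 = \frac{\eta^{1/4}+\eta^{-1/4}}{\sqrt 2},\qquad k_2 = \frac{\sqrt\eta+1}{2}.$$ Then the function $v \mapsto \mathcal{S}_\alpha(\max(v,m))$ is an $l_0$-sub-gamma uniform boundary with scale $c$ and crossing probability $\alpha$. Further, for any pair $(S_t,V_t)$ such that $(S_t)$ is $l_0$-sub-gamma with scale $c$ and variance process $(V_t)$, and any $v_0 \ge m$, $$\mathbb{P}\left(\exists t\ge 1:\ V_t \ge v_0 \text{ and } S_t \ge \mathcal{S}_\alpha(V_t)\right) \le \sum_{k=\lfloor \log_\eta(v_0/m)\rfloor}^\infty \frac{\alpha}{h(k)}.$$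
   Context: Sub-$\psi$ condition: let $(S_t)_{t=0}^\infty$, $(V_t)_{t=0}^\infty$ be real-valued processes adapted to a filtration $(\mathcal F_t)_{t=0}^\infty$ with $S_0=V_0=0$ and $V_t\ge 0$ for all $t$. For $\psi:[0,\lambda_{\max})\to\mathbb{R}$ and $l_0\in[1,\infty)$, $(S_t)$ is $l_0$-sub-$\psi$ with variance process $(V_t)$ if for each $\lambda\in[0,\lambda_{\max})$ there is a supermartingale $(L_t(\lambda))_{t=0}^\infty$ with respect to $(\mathcal F_t)$ with $\mathbb{E}L_0(\lambda)\le l_0$ and $\exp\{\lambda S_t-\psi(\lambda)V_t\}\le L_t(\lambda)$ a.s. for all $t$. Uniform boundary: $u$ is an $l_0$-sub-$\psi$ uniform boundary with crossing probability $\alpha$ if $\mathbb{P}(\exists t\ge 1: S_t\ge u(V_t))\le\alpha$ for every pair $(S_t,V_t)$ such that $(S_t)$ is $l_0$-sub-$\psi$ with variance process $(V_t)$. Sub-gamma with scale $c$ means sub-$\psi$ with $\psi=\psi_{G,c}$, $\psi_{G,c}(\lambda)=\lambda^2/(2(1-c\lambda))$ on $0\le\lambda<1/\max(c,0)$, with $1/0=\infty$. *)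

(* Defs.v *)
From mathcomp Require Export all_boot all_order all_algebra.
From mathcomp Require Export all_classical all_reals all_analysis.

Set Implicit Arguments.
Unset Strict Implicit.
Unset Printing Implicit Defensive.

Import Order.TTheory GRing.Theory Num.Theory.
Import numFieldNormedType.Exports.

Local Open Scope classical_set_scope.
Local Open Scope ring_scope.

Definition is_filtration d (T : measurableType d) (F : nat -> set (set T)) :=
  [/\ forall t, sigma_algebra setT (F t),
      forall t, F t `<=` measurable &
      forall s t, (s <= t)%N -> F s `<=` F t].

(* When [G] is a sigma-algebra, [g_sigma_algebraType G] is the space whose
   measurable sets are exactly the elements of [G]. *)
Definition measurable_wrt (R : realType) (T : pointedType) (G : set (set T))
    (X : T -> R) :=
  measurable_fun (setT : set (g_sigma_algebraType G)) X.

Definition adapted d (T : measurableType d) (R : realType)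
    (F : nat -> set (set T)) (X : nat -> T -> R) :=
  forall t, measurable_wrt (F t) (X t).

(* [Y] is a version of the conditional expectation of the integrable random
   variable [X] given the sub-sigma-algebra [G]. *)
Definition is_cond_expectation d (T : measurableType d) (R : realType)
    (P : probability T R) (G : set (set T)) (X Y : T -> R) :=
  [/\ measurable_wrt G Y,
      P.-integrable setT (EFin \o Y) &
      forall A, G A ->
        (\int[P]_(w in A) (Y w)%:E = \int[P]_(w in A) (X w)%:E)%E].

Definition supermartingale d (T : measurableType d) (R : realType)
    (P : probability T R) (F : nat -> set (set T)) (L : nat -> T -> R) :=
  [/\ adapted F L,
      forall t, P.-integrable setT (EFin \o L t) &
      forall t, exists2 Y : T -> R,
        is_cond_expectation P (F t) (L t.+1) Y &
        {ae P, forall w, Y w <= L t w}].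

(* [psi] is only meaningful on [0, lmax), the only place where it is used. *)
Definition sub_psi d (T : measurableType d) (R : realType)
    (P : probability T R) (F : nat -> set (set T))
    (psi : R -> R) (lmax : \bar R) (l0 : R) (S V : nat -> T -> R) :=
  [/\ is_filtration F,
      adapted F S /\ adapted F V,
      forall w, S 0%N w = 0 /\ V 0%N w = 0,
      forall t w, 0 <= V t w &
      forall lam : R, 0 <= lam -> (lam%:E < lmax)%E ->
        exists L : nat -> T -> R,
          [/\ supermartingale P F L,
              ('E_P[L 0%N] <= l0%:E)%E &
              forall t, {ae P, forall w,
                expR (lam * S t w - psi lam * V t w) <= L t w}]].

(* [P] carries information only on measurable sets: the crossing event is one
   whenever [u] is Borel on [0, +oo). *)
Definition uniform_boundary (R : realType) (psi : R -> R) (lmax : \bar R)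
    (l0 alpha : R) (u : R -> R) :=
  forall (d : measure_display) (T : measurableType d) (P : probability T R)
    (F : nat -> set (set T)) (S V : nat -> T -> R),
  sub_psi P F psi lmax l0 S V ->
  (P [set w | exists2 t, (1 <= t)%N & (S t w >= u (V t w))%R] <= alpha%:E)%E.

Definition psi_gamma (R : realType) (c lam : R) : R :=
  lam ^+ 2 / (2 * (1 - c * lam)).

(* The inverse is the one of \bar R, for which 0^-1 = +oo. *)
Definition gamma_lmax (R : realType) (c : R) : \bar R :=
  (((Num.max c 0)%R)%:E^-1)%E.

Definition sub_gamma d (T : measurableType d) (R : realType)
    (P : probability T R) (F : nat -> set (set T)) (c l0 : R)
    (S V : nat -> T -> R) :=
  sub_psi P F (psi_gamma c) (gamma_lmax c) l0 S V.

Definition sub_gamma_uniform_boundary (R : realType) (c l0 alpha : R)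
    (u : R -> R) :=
  uniform_boundary (psi_gamma c) (gamma_lmax c) l0 alpha u.

Definition logb (R : realType) (b x : R) : R := ln x / ln b.

Definition stitch_ell (R : realType) (alpha eta m l0 : R) (h : R -> R)
    (v : R) : R :=
  ln (h (logb eta (v / m))) + ln (l0 / alpha).

Definition stitch_k1 (R : realType) (eta : R) : R :=
  (eta `^ (1 / 4) + eta `^ (- (1 / 4))) / Num.sqrt 2.

Definition stitch_k2 (R : realType) (eta : R) : R := (Num.sqrt eta + 1) / 2.

Definition stitched_boundary (R : realType) (c alpha eta m l0 : R)
    (h : R -> R) (v : R) : R :=
  let l := stitch_ell alpha eta m l0 h v in
  let k1 := stitch_k1 eta in
  let k2 := stitch_k2 eta in
  Num.sqrt (k1 ^+ 2 * v * l + k2 ^+ 2 * c ^+ 2 * l ^+ 2) + k2 * c * l.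

(* Main.v *)
(** Cut the values of [V] into the geometric epochs [m eta^k, m eta^(k+1)].  For
    each [lam], Ville's inequality for the supermartingale dominating
    [exp (lam S - psi lam V)] bounds the probability that [S] ever crosses the line
    [(r + psi lam V) / lam] by [l0 exp (- r)].  In epoch [k] use the level
    [r = ln (h k) + ln (l0 / alpha)], which makes this bound [alpha / h k], and
    the [lam] with [psi lam = r / s], where [s = m eta^(k + 1/2)] is the geometric
    midpoint of the epoch.  There the line lies below the stitched boundary, because
    [x + 1 / x <= sqrt eta + 1 / sqrt eta] for [x = V / s], and a union bound over
    the epochs concludes. *)

Require Import Defs.
From mathcomp Require Import ring lra measurable_realfun.

Set Implicit Arguments.
Unset Strict Implicit.
Unset Printing Implicit Defensive.

Import Order.TTheory GRing.Theory Num.Theory.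
Import numFieldNormedType.Exports.

Local Open Scope classical_set_scope.
Local Open Scope ring_scope.

(** * Ville's maximal inequality for discrete-time supermartingales *)

Section ville.
Context d (T : measurableType d) (R : realType) (P : probability T R).

(** Deleting the exceptional null set changes neither integral, and on the rest of [D] the
    comparison is pointwise. *)
Lemma ae_le_integrable (D : set T) (f g : T -> \bar R) :
  measurable D -> P.-integrable D f -> P.-integrable D g ->
  {ae P, forall w, (f w <= g w)%E} ->
  (\int[P]_(w in D) f w <= \int[P]_(w in D) g w)%E.
Proof.
move=> mD intf intg [N [mN PN0 subN]].
rewrite (negligible_integral mN mD intf PN0) (negligible_integral mN mD intg PN0).
have mDN : measurable (D `\` N) by exact: measurableD.
apply: le_integral => //.
- by apply: (integrableS mD) => //; exact: subDsetl.
- by apply: (integrableS mD) => //; exact: subDsetl.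
- move=> w /set_mem[_ nNw]; apply: contrapT => nle; exact/nNw/subN.
Qed.

Lemma measurable_wrt_preimage (G : set (set T)) (X : T -> R) (B : set R) :
  sigma_algebra setT G -> measurable_wrt G X -> measurable B -> G (X @^-1` B).
Proof.
move=> sG mX mB; rewrite -(measurable_g_measurableTypeE sG) -[X in _ X]setTI.
exact: mX.
Qed.

Lemma adapted_measurable (F : nat -> set (set T)) (X : nat -> T -> R) :
  is_filtration F -> adapted F X -> forall t, measurable_fun setT (X t).
Proof.
move=> [sF subF _] aX t _ B mB; rewrite setTI.
exact/(subF t)/(measurable_wrt_preimage (sF t) (aX t) mB).
Qed.

Lemma sigma_algebra_setU (G : set (set T)) A B :
  sigma_algebra setT G -> G A -> G B -> G (A `|` B).
Proof.
move=> [G0 _ GU] GA GB; rewrite -bigcup2E; apply: GU => -[//|[//|k]].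
exact: G0.
Qed.

Section crossing.
Variables (F : nat -> set (set T)) (L : nat -> T -> R) (a : R).
Hypotheses (filF : is_filtration F) (smL : supermartingale P F L).

Let hit t := L t @^-1` `[a, +oo[.
Let reach n := \bigcup_(t < n.+1) hit t.

Let reach0 : reach 0 = hit 0.
Proof. by rewrite /reach bigcup_mkord big_ord1. Qed.

Let reachS n : reach n.+1 = reach n `|` hit n.+1.
Proof. by rewrite /reach !bigcup_mkord big_ord_recr. Qed.

Let F_hit t : F t (hit t).
Proof.
case: filF => sF _ _; case: smL => aL _ _.
exact: (measurable_wrt_preimage (sF t) (aL t)).
Qed.

Let F_reach n : F n (reach n).
Proof.
case: filF => sF _ leF; elim: n => [|n IHn]; first by rewrite reach0.
rewrite reachS; apply: sigma_algebra_setU => //; exact: (leF n).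
Qed.

Let measurable_hit t : measurable (hit t).
Proof. by case: filF => _ subF _; exact/(subF t)/F_hit. Qed.

Let measurable_reach n : measurable (reach n).
Proof. by case: filF => _ subF _; exact/(subF n)/F_reach. Qed.

Let integrable_on t D : measurable D -> P.-integrable D (EFin \o L t).
Proof.
by case: smL => _ iL _ mD; exact: (integrableS measurableT mD (@subsetT _ _)).
Qed.

Let hit_integral t D : measurable D -> D `<=` hit t ->
  (a%:E * P D <= \int[P]_(w in D) (L t w)%:E)%E.
Proof.
move=> mD sub; rewrite -integral_cst//; apply: le_integral => //.
- exact: finite_measure_integrable_cst.
- exact: integrable_on.
- move=> w /set_mem/sub; rewrite /hit/= in_itv/= andbT => aL.
  by rewrite lee_fin.
Qed.

Let integral_setID t A B : measurable A -> measurable B ->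
  (\int[P]_(w in A) (L t w)%:E =
   \int[P]_(w in A `&` B) (L t w)%:E + \int[P]_(w in A `\` B) (L t w)%:E)%E.
Proof.
move=> mA mB; rewrite -integral_setU ?setUIDK//.
- exact: measurableI.
- exact: measurableD.
- have /measurable_int : P.-integrable A (EFin \o L t) by exact: integrable_on.
  by [].
- by rewrite disj_set2E; apply/eqP/seteqP; split=> // w [[_ Bw] [_]].
Qed.

(* The left-hand side is the expectation of [L] stopped when it first reaches
   level [a], with each stopped value lowered to [a]. *)
Let stopped_le n :
  (a%:E * P (reach n) + \int[P]_(w in ~` reach n) (L n w)%:E
     <= \int[P]_w (L 0%N w)%:E)%E.
Proof.
elim: n => [|n IHn].
  rewrite reach0 (integral_setID 0 measurableT (measurable_hit 0)) setTI setTD.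
  by apply: leeD => //; exact: hit_integral.
have mA : measurable (~` reach n) by exact: measurableC.
have -> : ~` reach n.+1 = ~` reach n `\` hit n.+1.
  by rewrite reachS setCU setDE.
have -> : P (reach n.+1) = (P (reach n) + P (~` reach n `&` hit n.+1))%E.
  rewrite reachS -measureU//.
  - by rewrite setUIr setUv setTI.
  - exact: measurableI.
  - by rewrite setIA setICr set0I.
rewrite ge0_muleDr// -addeA; apply: le_trans IHn; apply: leeD => //.
(* Paths that first hit at time [n.+1] contribute at least [a] times their probability to this
   integral. *)
apply: (@le_trans _ _ (\int[P]_(w in ~` reach n) (L n.+1 w)%:E)%E).
  rewrite (integral_setID n.+1 mA (measurable_hit n.+1)); apply: leeD => //.
  by apply: hit_integral; [exact: measurableI|exact: subIsetr].
(* The complement of [reach n] lies in [F n], so on it [L n.+1] has the same integral as [Y], which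
   is almost surely at most [L n]. *)
have [_ _ /(_ n)[Y [_ iY eY] leY]] := smL.
case: filF => sF _ _; have [_ Fc _] := sF n.
rewrite -eY -?setTD; last exact: Fc.
rewrite setTD; apply: ae_le_integrable => //.
- exact: (integrableS measurableT mA (@subsetT _ _)).
- exact: integrable_on.
Qed.

(** Nonnegativity lets the integral over unstopped paths be dropped from [stopped_le]; continuity
    from below then passes from finite horizons to all times. *)
Lemma ville_inequality : (forall t, {ae P, forall w, 0 <= L t w}) ->
  (a%:E * P (\bigcup_t (L t @^-1` `[a, +oo[)) <= 'E_P[L 0%N])%E.
Proof.
move=> L_ge0; rewrite unlock.
have reach_le n : (a%:E * P (reach n) <= \int[P]_w (L 0%N w)%:E)%E.
  apply: le_trans (stopped_le n); rewrite leeDl//.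
  have mA : measurable (~` reach n) by exact: measurableC.
  rewrite -(@integral0 _ _ _ P (~` reach n)); apply: ae_le_integrable => //.
  - exact: integrable0.
  - exact: integrable_on.
  - by apply: filterS (L_ge0 n) => w; rewrite lee_fin.
have -> : \bigcup_t (L t @^-1` `[a, +oo[) = \bigcup_n reach n.
  apply/seteqP; split=> w [t _ Lt]; first by exists t => //; exists t => /=.
  by case: Lt => s _ ?; exists s.
have cvg_reach : (a%:E * P (reach n))%E @[n --> \oo] -->
    (a%:E * P (\bigcup_n reach n))%E.
  apply: cvgeZl => //; apply: nondecreasing_cvg_mu => //.
  - exact: bigcupT_measurable.
  - move=> m n mn; apply/subsetPset => w [t /= tm Lt].
    by exists t => //=; exact: leq_trans mn.
rewrite -(cvg_lim _ cvg_reach)//; apply: lime_le.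
  by apply: cvgP cvg_reach.
exact: nearW.
Qed.

End crossing.
End ville.

(** * Probability of crossing a line under the sub-[psi] condition *)

Section line_crossing.
Context d (T : measurableType d) (R : realType) (P : probability T R).
Variables (F : nat -> set (set T)) (psi : R -> R) (lmax : \bar R) (l0 : R).
Variables (S V : nat -> T -> R).
Hypothesis subS : sub_psi P F psi lmax l0 S V.

Let mS t : measurable_fun setT (S t).
Proof. by case: subS => filF [aS _] _ _ _; exact: (adapted_measurable filF aS). Qed.

Let mV t : measurable_fun setT (V t).
Proof. by case: subS => filF [_ aV] _ _ _; exact: (adapted_measurable filF aV). Qed.

Let mZ (lam mu : R) t : measurable_fun setT (fun w => lam * S t w - mu * V t w).
Proof. by apply: measurable_funB; apply: measurable_funM. Qed.

Lemma measurable_line_crossing (lam mu r : R) :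
  measurable (\bigcup_t [set w | r <= lam * S t w - mu * V t w]).
Proof.
apply: bigcupT_measurable => t; rewrite -[X in measurable X]setTI.
by apply: measurable_fun_le => //; exact: measurable_cst.
Qed.

Lemma measurable_crossing (D : set nat) (u : R -> R) (v0 : R) :
  measurable_fun setT u ->
  measurable (\bigcup_(t in D) [set w | v0 <= V t w /\ u (V t w) <= S t w]).
Proof.
move=> mu; apply: bigcup_measurable => t _.
rewrite (_ : mkset _ = (setT `&` [set w | v0 <= V t w]) `&`
   (setT `&` [set w | u (V t w) <= S t w])); last first.
  by apply/seteqP; split=> w /=; tauto.
apply: measurableI; apply: measurable_fun_le => //.
exact: (measurableT_comp mu).
Qed.

(** Crossing the line pushes the dominating supermartingale up to [expR r] almost surely, where
    Ville's inequality applies. *)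
Lemma line_crossing_prob (lam r : R) : 0 <= lam -> (lam%:E < lmax)%E ->
  (P (\bigcup_t [set w | (r <= lam * S t w - psi lam * V t w)%R])
    <= (l0 * expR (- r))%:E)%E.
Proof.
move=> lam0 lamm; case: subS => filF _ _ _ /(_ lam lam0 lamm)[L [smL EL0 leL]].
have [aL iL _] := smL.
(* The countably many almost sure bounds hold together outside one null set [N]. *)
have [N [mN PN0 subN]] := ae_foralln leL.
set A := \bigcup_t (L t @^-1` `[expR r, +oo[).
have mA : measurable A.
  apply: bigcupT_measurable => t; rewrite -[X in measurable X]setTI.
  exact: (adapted_measurable filF aL).
apply: (@le_trans _ _ (P (A `|` N))).
  apply: le_measure; rewrite ?inE.
  - exact: measurable_line_crossing.
  - exact: measurableU.
  - move=> w [t _ /= rle]; have [Nw|nNw] := pselect (N w); [by right|left].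
    exists t => //=; rewrite in_itv/= andbT.
    have {}leL : forall t, expR (lam * S t w - psi lam * V t w) <= L t w.
      by apply: contrapT => nle; exact/nNw/subN.
    by apply: le_trans (leL t); rewrite ler_expR.
apply: le_trans (measureU2 _ _ _) _ => //.
rewrite [X in (_ + X)%E](_ : _ = 0%E)// adde0 expRN.
rewrite EFinM -(@lee_pmul2l _ (expR r)%:E)// ?lte_fin ?expR_gt0//.
rewrite -!EFinM mulrCA divff ?gt_eqF ?expR_gt0// mulr1.
apply: le_trans EL0; apply: (ville_inequality _ filF smL) => t.
by apply: filterS (leL t) => w; apply: le_trans; exact: expR_ge0.
Qed.

End line_crossing.

(** * The line attached to an epoch and its comparison with the stitched boundary *)

Section stitching.
Context (R : realType).
Implicit Types c r s v l eta : R.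

(* The reciprocal of the positive root [lam] of [psi_gamma c lam = r / s]. *)
Definition line_slope c r s : R :=
  (c * r + Num.sqrt (c ^+ 2 * r ^+ 2 + 2 * r * s)) / (2 * r).

Section slope.
Variables c r s : R.
Hypotheses (c_ge0 : 0 <= c) (r_gt0 : 0 < r) (s_gt0 : 0 < s).
Let mu := line_slope c r s.

(** The square root exceeds [c * r] because [2 * r * s] is positive. For [lam = mu^-1] this means
    [c * lam < 1], which keeps [lam] in the domain of [psi_gamma c]. *)
Lemma line_slope_gt : c < mu.
Proof.
rewrite /mu /line_slope ltr_pdivlMr ?mulr_gt0//.
have cr_ge0 : 0 <= c * r by rewrite mulr_ge0// ltW.
have rs_gt0 : 0 < r * s by rewrite mulr_gt0.
suff : c * r < Num.sqrt (c ^+ 2 * r ^+ 2 + 2 * r * s) by lra.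
by rewrite -[X in X < _]ger0_norm// -sqrtr_sqr ltr_sqrt ?exprMn; nra.
Qed.

Lemma line_slope_gt0 : 0 < mu.
Proof. exact: le_lt_trans line_slope_gt. Qed.

(** This is [psi_gamma c mu^-1 = r / s] cleared of denominators. *)
Lemma line_slope_eq : 2 * r * mu ^+ 2 = 2 * c * r * mu + s.
Proof.
have rs_gt0 : 0 < r * s by rewrite mulr_gt0.
set D := c ^+ 2 * r ^+ 2 + 2 * r * s.
have : Num.sqrt D ^+ 2 = D by rewrite sqr_sqrtr// /D; nra.
have -> : Num.sqrt D = 2 * r * mu - c * r.
  by rewrite /mu /line_slope -/D; field; rewrite gt_eqF.
rewrite /D => eqD; apply: (@mulfI _ r); first by rewrite gt_eqF.
by nra.
Qed.

Lemma psi_gamma_line_slope : psi_gamma c mu^-1 = r / s.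
Proof.
have mu0 := line_slope_gt0; have muc := line_slope_gt.
rewrite /psi_gamma; have := line_slope_eq => E.
have -> : s = 2 * r * mu * (mu - c) by lra.
field; rewrite !gt_eqF//= ?subr_gt0//.
Qed.

Lemma line_slopeV_lt_lmax : (mu^-1%:E < gamma_lmax c)%E.
Proof.
rewrite /gamma_lmax max_l//.
have [->|c0] := eqVneq c 0; first by rewrite inve0 ltry.
rewrite inver (negbTE c0) lte_fin ltf_pV2 ?posrE ?line_slope_gt0 ?line_slope_gt//.
by rewrite lt_neqAle eq_sym c0.
Qed.

End slope.

(** With [y = eta^(1/4)], the sum [y + 1 / y] squares to [y^2 + 1 / y^2 + 2], and [y^2] is the
    square root of [eta]. *)
Lemma sqr_stitch_k1 eta : 0 < eta ->
  stitch_k1 eta ^+ 2 = (Num.sqrt eta + (Num.sqrt eta)^-1 + 2) / 2.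
Proof.
move=> eta0; rewrite /stitch_k1 powRN; set y := eta `^ (1 / 4).
have y0 : 0 < y by rewrite powR_gt0.
have -> : Num.sqrt eta = y ^+ 2.
  rewrite -powR12_sqrt ?ltW// -powR_mulrn ?ltW// /y -powRrM.
  by congr (_ `^ _); field.
rewrite expr_div_n sqr_sqrtr//; field; rewrite gt_eqF//.
Qed.

(** Here [l] is decoupled from [v], so that any [l] above the level [r] can be used;
    [l = stitch_ell alpha eta m l0 h v] gives back [stitched_boundary] by conversion. *)
Definition stitch_formula eta c v l : R :=
  Num.sqrt (stitch_k1 eta ^+ 2 * v * l + stitch_k2 eta ^+ 2 * c ^+ 2 * l ^+ 2)
  + stitch_k2 eta * c * l.

(** With [x = v / s], the line equals [(1 + x) / 2] times [sqrt (c^2 r^2 + 2 r s) + c r]. The terms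
    in [c] are bounded through [(1 + x) / 2 <= k2] and [r <= l], the term [2 r s] through
    [(1 + x)^2 <= 2 k1^2 x]. *)
Lemma line_le_stitch eta c r s v l : 1 < eta -> 0 <= c -> 0 < r -> 0 < s ->
  s / Num.sqrt eta <= v <= s * Num.sqrt eta -> r <= l ->
  line_slope c r s * (r + r / s * v) <= stitch_formula eta c v l.
Proof.
move=> eta1 c0 r0 s0 /andP[vl vu] rl; rewrite /stitch_formula sqr_stitch_k1; last lra.
rewrite /stitch_k2; set q := Num.sqrt eta in vl vu *.
have q0 : 0 < q by rewrite sqrtr_gt0; lra.
have [x vE] : {x | v = s * x} by exists (v / s); field; rewrite gt_eqF.
rewrite {}vE in vl vu *.
rewrite ler_pM2l// in vl; rewrite ler_pM2l// in vu.
have qV0 : 0 < q^-1 by rewrite invr_gt0.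
have x0 : 0 < x by exact: lt_le_trans vl.
have l0 : 0 < l by exact: lt_le_trans rl.
have h0 : 0 <= (1 + x) / 2 by lra.
have le_ck : c * r <= c * l by rewrite ler_wpM2l.
have cr_ge0 : 0 <= c * r by rewrite mulr_ge0// ltW.
have cl_ge0 : 0 <= c * l by exact: le_trans le_ck.
have le_k2 : (1 + x) / 2 <= (q + 1) / 2 by lra.
have -> : line_slope c r s * (r + r / s * (s * x)) =
    (1 + x) / 2 * Num.sqrt (c ^+ 2 * r ^+ 2 + 2 * r * s) + (1 + x) / 2 * (c * r).
  by rewrite /line_slope; field; rewrite !gt_eqF.
apply: lerD; last first.
  by rewrite -[leRHS]mulrA; apply: ler_pM.
(* The factor [(1 + x) / 2] goes under the root, so that the radicands compare term by term. *)
rewrite -{1}(ger0_norm h0) -sqrtr_sqr -sqrtrM ?sqr_ge0// ler_wsqrtr// mulrDr addrC.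
apply: lerD.
  (* [x |-> x + 1 / x] is largest at the endpoints of [1 / q, q] *)
  have xq : 1 + x ^+ 2 <= (q + q^-1) * x.
    have : 0 <= (q - x) * (x - q^-1) by rewrite mulr_ge0// subr_ge0.
    have : q * q^-1 = 1 by rewrite divff// gt_eqF.
    nra.
  have -> : ((1 + x) / 2) ^+ 2 * (2 * r * s) = (1 + x) ^+ 2 / 2 * s * r by field.
  have -> : (q + q^-1 + 2) / 2 * (s * x) * l =
      ((q + q^-1 + 2) * x / 2 * s) * l by field; rewrite gt_eqF.
  apply: ler_pM => //.
  - by rewrite mulr_ge0 ?divr_ge0 ?sqr_ge0// ltW.
  - exact: ltW.
  - apply: ler_wpM2r; [exact: ltW|apply: ler_wpM2r; [by rewrite invr_ge0|lra]].
rewrite -!exprMn -[(_ * c) * l]mulrA ler_sqr ?nnegrE.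
- exact: ler_pM.
- exact: mulr_ge0.
- by apply: mulr_ge0 => //; exact: le_trans le_k2.
Qed.

End stitching.

(** * Geometric epochs and the union bound *)

Section epochs.
Context (R : realType) (c alpha eta m l0 : R) (h : R -> R).
Hypotheses (c_ge0 : 0 <= c) (alpha_gt0 : 0 < alpha) (alpha_lt1 : alpha < 1).
Hypotheses (eta_gt1 : 1 < eta) (m_gt0 : 0 < m) (l0_ge1 : 1 <= l0).
Hypothesis h_ge0 : forall x, 0 <= x -> 0 <= h x.
Hypothesis h_incr : forall x y, 0 <= x -> x <= y -> h x <= h y.
Hypothesis h_sum : (\sum_(0 <= k <oo) ((h k%:R)%:E)^-1 <= 1)%E.

Let ell := stitch_ell alpha eta m l0 h.
Let boundary v := stitched_boundary c alpha eta m l0 h (Num.max v m).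
Let epoch v := Num.truncn (logb eta (v / m)).
Let level k := ln (h k%:R) + ln (l0 / alpha).
Let slope k := line_slope c (level k) (m * eta ^+ k * Num.sqrt eta).

(** The single term [1 / h 0] of the series is already at most 1, and [h] increases. This makes the
    logarithms of [h] nonnegative and the levels positive. *)
Lemma h_ge1 x : 0 <= x -> 1 <= h x.
Proof.
move=> x0; apply: le_trans (h_incr (lexx 0) x0).
have inv_le1 : (((h 0)%:E)^-1 <= 1)%E.
  apply: le_trans h_sum; rewrite -[X in h X]/(0%:R).
  apply: le_trans (nneseries_lim_ge 1 _) => [|k _ _].
    by rewrite big_nat1.
  by rewrite inve_ge0 lee_fin h_ge0.
(* In [\bar R] the inverse of 0 is [+oo], so [h 0 = 0] contradicts the bound. *)
have [h0|h0] := eqVneq (h 0) 0; first by move: inv_le1; rewrite h0 inve0.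
move: inv_le1; rewrite inver (negbTE h0) lee_fin invf_le1//.
by rewrite lt_neqAle eq_sym h0 h_ge0.
Qed.

Let eta_gt0 : 0 < eta. Proof. exact: lt_trans eta_gt1. Qed.

Let ln_eta_gt0 : 0 < ln eta. Proof. exact: ln_gt0. Qed.

Let ln_l0alpha_gt0 : 0 < ln (l0 / alpha).
Proof. by rewrite ln_gt0// ltr_pdivlMr// mul1r; exact: lt_le_trans l0_ge1. Qed.

Lemma le_logb x y : 0 < x -> x <= y -> logb eta x <= logb eta y.
Proof.
move=> x0 xy; apply: ler_wpM2r; first by rewrite invr_ge0 ltW.
by rewrite ler_ln ?posrE// (lt_le_trans x0).
Qed.

Lemma logb_ge0 x : 1 <= x -> 0 <= logb eta x.
Proof. by move=> x1; rewrite /logb divr_ge0 ?ln_ge0// ltW. Qed.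

Let divm_ge1 v : m <= v -> 1 <= v / m.
Proof. by rewrite ler_pdivlMr// mul1r. Qed.

Let divm_gt0 v : m <= v -> 0 < v / m.
Proof. by move=> /divm_ge1; exact: lt_le_trans. Qed.

Lemma le_epoch v w : m <= v -> v <= w -> (epoch v <= epoch w)%N.
Proof.
move=> mv vw; apply: le_truncn; apply: le_logb; first exact: divm_gt0.
by rewrite ler_wpM2r// invr_ge0 ltW.
Qed.

Lemma epoch_itv v : m <= v -> m * eta ^+ epoch v <= v <= m * eta ^+ (epoch v).+1.
Proof.
move=> mv; have v0 := divm_gt0 mv.
have etaX0 k : 0 < eta ^+ k by rewrite exprn_gt0.
have /truncn_itv/andP[] : 0 <= logb eta (v / m) by exact/logb_ge0/divm_ge1.
rewrite -/(epoch v) ler_pdivlMr// => lel /ltW; rewrite ler_pdivrMr// => leu.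
rewrite ![m * _]mulrC -ler_pdivlMr// -[X in _ && X](ler_pdivrMr _ _ m_gt0).
rewrite -(@ler_ln _ (eta ^+ _)) ?posrE// -(@ler_ln _ (v / m)) ?posrE//.
by rewrite !lnXn// -!(mulr_natl (ln eta)) lel leu.
Qed.

Lemma level_gt0 k : 0 < level k.
Proof. by rewrite ltr_wpDl// ln_ge0// h_ge1. Qed.

(** Truncation rounds the logarithm down, and [h] increases. *)
Lemma level_le_ell v : m <= v -> level (epoch v) <= ell v.
Proof.
move=> mv; have L0 := logb_ge0 (divm_ge1 mv).
rewrite /level /ell /stitch_ell lerD2r ler_ln ?posrE ?(lt_le_trans ltr01)// ?h_ge1//.
by apply: h_incr => //; case/andP: (truncn_itv L0).
Qed.

Let etaX_gt0 k : 0 < m * eta ^+ k * Num.sqrt eta.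
Proof. by rewrite !mulr_gt0 ?exprn_gt0 ?sqrtr_gt0. Qed.

Lemma slope_gt0 k : 0 < slope k.
Proof. exact: line_slope_gt0 (level_gt0 k) (etaX_gt0 k). Qed.

Lemma slopeV_lt_lmax k : ((slope k)^-1%:E < gamma_lmax c)%E.
Proof. exact: line_slopeV_lt_lmax (level_gt0 k) (etaX_gt0 k). Qed.

(* Times with [V < m] belong to epoch 0, since the line increases with [V]. *)
Lemma boundary_crosses_line k v y :
  k = epoch (Num.max v m) -> boundary v <= y ->
  level k <= (slope k)^-1 * y - psi_gamma c (slope k)^-1 * v.
Proof.
set w := Num.max v m => kE le_y.
have mw : m <= w by rewrite le_max lexx orbT.
have vw : v <= w by rewrite le_max lexx.
have q0 : 0 < Num.sqrt eta by rewrite sqrtr_gt0.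
have qq : Num.sqrt eta * Num.sqrt eta = eta by rewrite -expr2 sqr_sqrtr// ltW.
(* Dividing or multiplying the geometric midpoint by the square root of [eta] gives the two ends of
   epoch [k]. *)
have witv : m * eta ^+ k * Num.sqrt eta / Num.sqrt eta <= w <=
            m * eta ^+ k * Num.sqrt eta * Num.sqrt eta.
  by rewrite mulfK ?gt_eqF// -[_ * _ * _ * _]mulrA qq -mulrA -exprSr kE epoch_itv.
have rl : level k <= ell w by rewrite kE level_le_ell.
have := line_le_stitch eta_gt1 c_ge0 (level_gt0 k) (etaX_gt0 k) witv rl.
move=> /le_trans/(_ le_y).
rewrite psi_gamma_line_slope ?level_gt0 ?etaX_gt0// -/(slope k).
rewrite -(ler_pdivlMl _ _ (slope_gt0 k)) => le_line.
(* The comparison was made at [w]; since [v <= w], the line is no higher at [v]. *)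
rewrite lerBrDr; apply: le_trans le_line; rewrite lerD2l ler_wpM2l//.
by rewrite divr_ge0 ?ltW ?level_gt0.
Qed.

(** The summand [ln (l0 / alpha)] of the level trades the factor [l0] for [alpha]. *)
Lemma level_prob k : l0 * expR (- level k) = alpha / h k%:R.
Proof.
have h0 : 0 < h k%:R by rewrite (lt_le_trans ltr01)// h_ge1.
have l0gt : 0 < l0 by exact: lt_le_trans l0_ge1.
rewrite /level -lnM ?posrE ?divr_gt0// expRN lnK ?posrE ?mulr_gt0 ?invr_gt0//.
by field; rewrite !gt_eqF.
Qed.

(** Monotonicity of [h] makes [ell (Num.max v m)] nondecreasing in [v], hence Borel; the rest is
    built from it by measurable operations. *)
Lemma measurable_boundary : measurable_fun setT boundary.
Proof.
have max_m v : m <= Num.max v m by rewrite le_max lexx orbT.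
have mmax : measurable_fun setT (fun v : R => Num.max v m).
  by apply: measurable_maxr => //; exact: measurable_cst.
have mell : measurable_fun setT (fun v : R => ell (Num.max v m)).
  apply: nondecreasing_measurable => // v w vw.
  rewrite /ell /stitch_ell lerD2r ler_ln ?posrE ?(lt_le_trans ltr01)//
    ?h_ge1 ?logb_ge0 ?divm_ge1//.
  apply: h_incr; first exact/logb_ge0/divm_ge1.
  apply: le_logb; first exact: divm_gt0.
  apply: ler_wpM2r; first by rewrite invr_ge0 ltW.
  rewrite ge_max max_m andbT.
  by rewrite le_max vw.
rewrite /boundary /stitched_boundary; apply: measurable_funD; last first.
  by apply: measurable_funM => //; exact: measurable_cst.
apply: (measurableT_comp (continuous_measurable_fun (@sqrt_continuous R))).
apply: measurable_funD; apply: measurable_funM => //; last exact: measurable_funX.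
exact: measurable_funM.
Qed.

(** Both claims of the theorem are instances: [v0 = 0] with [K = 0] for the uniform boundary, and
    [K] the epoch of [v0] for the tail bound. *)
Lemma stitched_crossing_prob d (T : measurableType d) (P : probability T R)
    (F : nat -> set (set T)) (S V : nat -> T -> R) (D : set nat) (v0 : R) (K : nat) :
  sub_gamma P F c l0 S V ->
  (forall v, v0 <= v -> (K <= epoch (Num.max v m))%N) ->
  (P (\bigcup_(t in D) [set w | (v0 <= V t w)%R /\ (boundary (V t w) <= S t w)%R])
    <= \sum_(K <= k <oo) (alpha%:E / (h k%:R)%:E))%E.
Proof.
move=> subS leK.
pose E k := \bigcup_t [set w |
  level k <= (slope k)^-1 * S t w - psi_gamma c (slope k)^-1 * V t w].
have mE k : measurable (E k) by exact: measurable_line_crossing subS _ _ _.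
have h_gt0 k : 0 < h k%:R by rewrite (lt_le_trans ltr01)// h_ge1.
have PE k : (P (E k) <= alpha%:E / (h k%:R)%:E)%E.
  rewrite inver gt_eqF// -EFinM -level_prob.
  apply: (line_crossing_prob subS); last exact: slopeV_lt_lmax.
  by rewrite invr_ge0 ltW// slope_gt0.
rewrite -nneseries_addn => [|k]; last first.
  by rewrite inver gt_eqF// -EFinM lee_fin divr_ge0// ltW.
apply: (@le_trans _ _ (\sum_(0 <= k <oo) P (E (k + K)%N))%E).
  apply: measure_sigma_subadditive => //.
    exact: (measurable_crossing subS _ _ measurable_boundary).
  (* A crossing at time [t] is charged to the epoch of [V t w], which is at least [K]; the index is
     shifted by [K] as in the series. *)
  move=> w [t _ [v0V bS]]; exists (epoch (Num.max (V t w) m) - K)%N => //.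
  by rewrite subnK ?leK//; exists t => //; exact: boundary_crosses_line.
by apply: lee_nneseries => // k _.
Qed.

Lemma sum_alpha_le : (\sum_(0 <= k <oo) (alpha%:E / (h k%:R)%:E) <= alpha%:E)%E.
Proof.
rewrite nneseriesZl => [|k _]; last by rewrite inve_ge0 lee_fin h_ge0.
by rewrite -[leRHS]mule1 lee_wpmul2l// lee_fin ltW.
Qed.

End epochs.

Theorem theorem1 (R : realType) (c alpha eta m l0 : R) (h : R -> R)
    (c_ge0 : 0 <= c) (alpha_gt0 : 0 < alpha) (alpha_lt1 : alpha < 1)
    (eta_gt1 : 1 < eta) (m_gt0 : 0 < m) (l0_ge1 : 1 <= l0)
    (h_ge0 : forall x, 0 <= x -> 0 <= h x)
    (h_incr : forall x y, 0 <= x -> x <= y -> h x <= h y)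
    (h_sum : (\sum_(0 <= k <oo) ((h k%:R)%:E)^-1 <= 1)%E) :
  sub_gamma_uniform_boundary c l0 alpha
    (fun v => stitched_boundary c alpha eta m l0 h (Num.max v m)) /\
  (forall (d : measure_display) (T : measurableType d) (P : probability T R)
      (F : nat -> set (set T)) (S V : nat -> T -> R) (v0 : R),
    sub_gamma P F c l0 S V ->
    m <= v0 ->
    (P [set w | exists2 t, (1 <= t)%N &
          (V t w >= v0)%R /\
          (S t w >= stitched_boundary c alpha eta m l0 h (V t w))%R]
      <= \sum_(Num.truncn (logb eta (v0 / m)) <= k <oo)
           (alpha%:E / (h k%:R)%:E))%E).
Proof.
split=> [d T P F S V subS|d T P F S V v0 subS mv0].
  apply: le_trans (sum_alpha_le alpha_gt0 h_ge0 h_sum).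
  have [_ _ _ V_ge0 _] := subS.
  (* Since [V] is nonnegative, the constraint [0 <= V t w] leaves the event unchanged. *)
  rewrite (_ : mkset _ = \bigcup_(t in [set t | (1 <= t)%N]) [set w | 0 <= V t w /\
    stitched_boundary c alpha eta m l0 h (Num.max (V t w) m) <= S t w]).
    by apply: stitched_crossing_prob => //; exact: subS.
  apply/seteqP; split=> w [t t1]; last by case=> _; exists t.
  by move=> crosses; exists t => //; split=> //; exact: V_ge0.
rewrite (_ : mkset _ = \bigcup_(t in [set t | (1 <= t)%N]) [set w | v0 <= V t w /\
    stitched_boundary c alpha eta m l0 h (Num.max (V t w) m) <= S t w]).
  apply: stitched_crossing_prob => //; first exact: subS.
  move=> v v0v; apply: le_epoch => //.
  by rewrite le_max v0v.
(* Here [V t w >= v0 >= m], so the maximum with [m] is [V t w]. *)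
by apply/seteqP; split=> w [t t1 [v0V crosses]]; exists t => //; split=> //;
  move: crosses; rewrite max_l// (le_trans mv0).
Qed.
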